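(* Let $X$ and $Y$ be normed spaces. Then the following statements hold. (i) $\mathcal{L}(X,Y)$ is always contained in $\mathcal{PL}(X,Y)$. (ii) $\mathcal{PL}_1(X,Y)\neq\emptyset$ if and only if $\dim(Y)<\infty$. Consequently, if $Y$ is infinite dimensional, then every linear function from $X$ to $Y$ is not in $\mathcal{PL}_1(X,Y)$. (iii) $\mathcal{PL}_1(X,Y)=\mathcal{PL}(X,Y)$ when $\dim(Y)<\infty$.
   Context: $\mathcal{L}(X,Y)$ is the space of all continuous linear operators from $X$ to $Y$. A (convex) polyhedron in a normed space $Z$ is a set of the form $\{z\in Z:\langle u_i^*,z\rangle\le s_i,\ i=1,\dots,n\}$ with finitely many $u_i^*\in Z^*$ (the topological dual) and $s_i\in\mathbb{R}$. $\mathcal{PL}_1(X,Y)$ is the set of all functions $f:X\to Y$ for which there exist finitely many polyhedra $\Lambda_1,\dots,\Lambda_m$ in the product space $X\times Y$ with $\mathrm{gph}(f):=\{(x,f(x)):x\in X\}=\bigcup_{i=1}^m\Lambda_i$. $\mathcal{PL}(X,Y)$ is the set of all functions $f:X\to Y$ for which there exist finitely many $T_i\in\mathcal{L}(X,Y)$, polyhedra $P_i$ in $X$ and $b_i\in Y$ ($i=1,\dots,m$) such that $X=\bigcup_{i=1}^mP_i$ and $f(x)=T_i(x)+b_i$ for all $x\in P_i$ and $i=1,\dots,m$. *)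

(* Defs.v *)
From HB Require Import structures.
From mathcomp Require Import all_boot all_order all_algebra.
From mathcomp Require Import all_classical all_reals all_analysis.
Set Implicit Arguments.
Unset Strict Implicit.
Unset Printing Implicit Defensive.
Import Order.TTheory GRing.Theory Num.Theory.
Import numFieldNormedType.Exports.
Local Open Scope classical_set_scope.
Local Open Scope ring_scope.

Definition continuous_linear (R : realType) (X Y : normedModType R) :
    set (X -> Y) :=
  [set T | linear T /\ continuous T].
Arguments continuous_linear {R} X Y _.

Definition topological_dual (R : realType) (Z : normedModType R) : set (Z -> R^o) :=
  continuous_linear Z R^o.
Arguments topological_dual {R} Z _.

(* The case n = 0 gives the whole space, as the functional 0 would. *)
Definition polyhedron (R : realType) (Z : normedModType R) : set (set Z) :=
  [set P | exists (n : nat) (u : 'I_n -> Z -> R^o) (s : 'I_n -> R),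
     (forall i, topological_dual Z (u i)) /\ P = [set z | forall i, u i z <= s i]].
Arguments polyhedron {R} Z _.

Definition gph (T U : Type) (f : T -> U) : set (T * U) :=
  [set (x, f x) | x in [set: T]].

Definition PL1 (R : realType) (X Y : normedModType R) : set (X -> Y) :=
  [set f | exists (m : nat) (L : 'I_m -> set (X * Y)),
     (forall i, polyhedron (X * Y)%type (L i)) /\ gph f = \bigcup_i L i].
Arguments PL1 {R} X Y _.

Definition PL (R : realType) (X Y : normedModType R) : set (X -> Y) :=
  [set f | exists (m : nat) (T : 'I_m -> X -> Y) (P : 'I_m -> set X)
                  (b : 'I_m -> Y),
     [/\ forall i, continuous_linear X Y (T i),
         forall i, polyhedron X (P i),
         [set: X] = \bigcup_i P i &
         forall i x, P i x -> f x = T i x + b i]].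
Arguments PL {R} X Y _.

(* Algebraic notion: existence of a finite spanning family. The library's
   vectType is not usable here, as it would be extra structure on the type. *)
Definition finite_dimensional (R : realType) (V : normedModType R) : Prop :=
  exists (n : nat) (e : 'I_n -> V),
    forall v : V, exists c : 'I_n -> R, v = \sum_(i < n) c i *: e i.

(* Main.v *)
(* Let a polyhedron [{(x, y) | u_i (x, y) <= s_i}] lie in the graph of [f]. At
   each of its points [(x, f x)] the constraints active there have no common
   zero in the [Y] direction; otherwise [f x] could be moved. Hence finitely
   many functionals separate the points of [Y], so [Y] is finite dimensional,
   and solving the active equalities for [y] gives [f x] as a continuous affine
   function [T_A x + b_A] depending only on the active set [A]. The sets
   [{x | (x, T_A x + b_A) satisfies all constraints}] are polyhedra of [X], and
   no projection of polyhedra is needed to get PL1 <= PL. Conversely, in a finite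
   dimensional [Y] coordinates are continuous, so [{0}] is a polyhedron, and the
   graph of an affine piece is a preimage of [{0}] intersected with a cylinder. *)
Require Import Defs.
From HB Require Import structures.
From mathcomp Require Import all_boot all_order all_algebra.
From mathcomp Require Import all_classical all_reals all_analysis.
Set Implicit Arguments.
Unset Strict Implicit.
Unset Printing Implicit Defensive.
Import Order.TTheory GRing.Theory Num.Theory.
Import numFieldNormedType.Exports.
Local Open Scope classical_set_scope.
Local Open Scope ring_scope.

(** * Functionals and dual vectors in a vector space *)

Lemma linear_bundle (K : pzRingType) (U V : lmodType K) (f : U -> V) :
  linear f -> exists F : {linear U -> V}, f = F.
Proof.
move=> lf.
by exists (HB.pack f (GRing.isLinear.Build K U V *:%R f lf) : {linear U -> V}).
Qed.

(* Gram-Schmidt for functionals: subtracting [\sum_j c j v *: g j] projects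
   onto the common kernel. *)
Lemma common_kernel_projection (K : fieldType) (V : lmodType K) (I : eqType)
    (r : seq I) (c : I -> {linear V -> K^o}) :
  uniq r -> exists g : I -> V,
    forall v i, i \in r -> c i (v - \sum_(j <- r) c j v *: g j) = 0.
Proof.
elim: r => [|i r IH] /=; first by move=> _; exists (fun=> 0).
have cZ k a v : c k (a *: v) = a * c k v by rewrite linearZ.
move=> /andP[ir /IH[g gP]]; pose h v := v - \sum_(j <- r) c j v *: g j.
(* Either [c i] vanishes on the range of [h], and [w = 0] serves, or some [h z] can be normalised so
   that [c i w = 1]. In both cases subtracting [c i (h v) *: w] from [h v] kills [c i]. *)
have [w [wr wi]] : exists w, (forall k, k \in r -> c k w = 0) /\
    forall v, c i (h v) * c i w = c i (h v).
  have [[z z0]|no] := pselect (exists z, c i (h z) != 0); last first.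
    exists 0; split=> [k _|v]; first by rewrite linear0.
    by rewrite linear0 mulr0; apply/esym/eqP/negP => /negP H; apply: no; exists v.
  exists ((c i (h z))^-1 *: h z); split=> [k kr|v]; first by rewrite cZ (gP _ _ kr) mulr0.
  by rewrite cZ mulVf// mulr1.
(* These vectors come from expanding [h v - c i (h v) *: w] and collecting the coefficient of each
   [c j v]. *)
exists (fun j => if j == i then w else g j - c i (g j) *: w) => v k.
have -> : v - \sum_(j <- i :: r) c j v *:
    (if j == i then w else g j - c i (g j) *: w) = h v - c i (h v) *: w.
  rewrite big_cons eqxx.
  have -> : \sum_(j <- r) c j v *: (if j == i then w else g j - c i (g j) *: w) =
      \sum_(j <- r) c j v *: g j - c i (\sum_(j <- r) c j v *: g j) *: w.
    rewrite linear_sum scaler_suml -sumrB; apply: eq_big_seq => j jr.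
    rewrite ifN; last by apply: contraNneq ir => <-.
    by rewrite scalerBr scalerA cZ.
  rewrite /h raddfB scalerBl !opprD !opprK !addrA; congr (_ + _).
  by rewrite addrAC.
rewrite inE (raddfB (c k) (h v)) /= cZ => /predU1P[->|kr]; first by rewrite wi subrr.
by rewrite wr// mulr0 subr0 (gP _ _ kr).
Qed.

(** When the common kernel is trivial, the projection onto it is zero, so the subtracted sum is [v]
    itself. *)
Lemma total_functionals_expansion (K : fieldType) (V : lmodType K)
    (I : finType) (A : {set I}) (c : I -> {linear V -> K^o}) :
  (forall v, (forall i, i \in A -> c i v = 0) -> v = 0) ->
  exists g : I -> V, forall v, v = \sum_(i in A) c i v *: g i.
Proof.
move=> tot; have [g gP] := common_kernel_projection c (enum_uniq A).
exists g => v; apply/eqP; rewrite -subr_eq0 -big_enum /=; apply/eqP/tot => i iA.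
by apply: gP; rewrite mem_enum.
Qed.

(** * Closure properties of continuous linear maps *)

Section continuous_linear_closure.
Context {R : realType}.
Implicit Types X Y Z : normedModType R.

Lemma continuous_linear_fst X Y : continuous_linear (X * Y)%type X fst.
Proof. by split => // x; exact: cvg_fst. Qed.

Lemma continuous_linear_snd X Y : continuous_linear (X * Y)%type Y snd.
Proof. by split => // x; exact: cvg_snd. Qed.

Lemma continuous_linear_pair X Y Z (f : X -> Y) (g : X -> Z) :
  continuous_linear X Y f -> continuous_linear X Z g ->
  continuous_linear X (Y * Z)%type (fun x => (f x, g x)).
Proof.
move=> [lf cf] [lg cg]; split=> [a u v|x]; first by rewrite lf lg.
by apply: cvg_pair; [exact: cf|exact: cg].
Qed.

Lemma continuous_linear_id X : continuous_linear X X id.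
Proof. by split => // x; exact: cvg_id. Qed.

Lemma continuous_linear_comp X Y Z (f : X -> Y) (g : Y -> Z) :
  continuous_linear X Y f -> continuous_linear Y Z g ->
  continuous_linear X Z (g \o f).
Proof.
move=> [lf cf] [lg cg]; split=> [a u v|x] /=; first by rewrite lf lg.
by apply: continuous_comp; [exact: cf|exact: cg].
Qed.

Lemma continuous_linear0 X Y : continuous_linear X Y (fun=> 0).
Proof.
by split=> [a u v|x]; [rewrite scaler0 addr0|exact: cst_continuous].
Qed.

Lemma continuous_linearD X Y (f g : X -> Y) :
  continuous_linear X Y f -> continuous_linear X Y g ->
  continuous_linear X Y (fun x => f x + g x).
Proof.
move=> [lf cf] [lg cg]; split=> [a u v|x].
  by rewrite lf lg scalerDr addrACA.
by apply: continuousD; [exact: cf|exact: cg].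
Qed.

Lemma continuous_linearN X Y (f : X -> Y) :
  continuous_linear X Y f -> continuous_linear X Y (fun x => - f x).
Proof.
move=> [lf cf]; split=> [a u v|x]; first by rewrite lf opprD scalerN.
by apply: continuousN; exact: cf.
Qed.

Lemma continuous_linear_scale X Y (f : X -> R^o) (y : Y) :
  topological_dual X f -> continuous_linear X Y (fun x => f x *: y).
Proof.
move=> [lf cf]; split=> [a u v|x]; first by rewrite lf scalerDl scalerA.
by apply: continuousZr_tmp; exact: cf.
Qed.

Lemma continuous_linear_sum X Y (I : Type) (r : seq I) (P : pred I)
    (f : I -> X -> Y) :
  (forall i, P i -> continuous_linear X Y (f i)) ->
  continuous_linear X Y (fun x => \sum_(i <- r | P i) f i x).
Proof.
move=> fP; split=> [a u v|x].
  rewrite scaler_sumr -big_split /=; apply: eq_bigr => i Pi.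
  by have [-> _] := fP i Pi.
apply: cvg_big => [|i Pi]; first exact: add_continuous.
by have [_] := fP i Pi; apply.
Qed.

End continuous_linear_closure.

(** * Polyhedra and affine pieces *)

Section polyhedra.
Context {R : realType}.
Implicit Types X Y Z : normedModType R.

Lemma polyhedron_finType Z (I : finType) (u : I -> Z -> R^o) (s : I -> R) :
  (forall i, topological_dual Z (u i)) ->
  polyhedron Z [set z | forall i, u i z <= s i].
Proof.
move=> uZ; exists #|I|, (fun k => u (enum_val k)), (fun k => s (enum_val k)).
split=> [k|]; first exact: uZ.
apply/seteqP; split=> z /= uz i; first exact: uz.
by have := uz (enum_rank i); rewrite enum_rankK.
Qed.

Lemma polyhedronI Z (P Q : set Z) :
  polyhedron Z P -> polyhedron Z Q -> polyhedron Z (P `&` Q).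
Proof.
move=> [n [u [s [uZ ->]]]] [m [v [t [vZ ->]]]].
rewrite (_ : _ `&` _ = [set z | forall i : 'I_n + 'I_m,
  match i with inl j => u j | inr j => v j end z <=
  match i with inl j => s j | inr j => t j end]).
  by apply: polyhedron_finType; case.
apply/seteqP; split=> [z [uz vz] [i|i]|z uvz] //=.
by split=> i; [exact: (uvz (inl i))|exact: (uvz (inr i))].
Qed.

Lemma polyhedron_preimage X Z (A : X -> Z) (b : Z) (P : set Z) :
  continuous_linear X Z A -> polyhedron Z P ->
  polyhedron X [set x | P (A x + b)].
Proof.
move=> AXZ [n [u [s [uZ ->]]]].
exists n, (fun i => u i \o A), (fun i => s i - u i b); split=> [i|].
  exact: continuous_linear_comp AXZ (uZ i).
apply/seteqP; split=> x /= ux i; move/(_ i): ux;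
  by have [/linear_bundle[F ->] _] := uZ i; rewrite linearD /= lerBrDr.
Qed.

Lemma polyhedron0 Z : polyhedron Z set0.
Proof.
(* The single constraint [0 <= -1] has no solution. *)
exists 1%N, (fun=> fun=> 0), (fun=> -1); split=> [_|].
  exact: continuous_linear0.
by apply/seteqP; split=> // z /(_ ord0); rewrite oppr_ge0 ler10.
Qed.

Lemma polyhedronT Z : polyhedron Z setT.
Proof.
exists 0%N, (fun=> fun=> 0), (fun=> 0); split=> [[]//|].
by apply/seteqP; split=> // z _ [].
Qed.

(** Here [T] and [b] are existential for a single piece, so that pieces can be built separately;
    [PL_affine_pieces] then collects them by choice. *)
Definition affine_piece X Y (f : X -> Y) (P : set X) : Prop :=
  polyhedron X P /\ exists (T : X -> Y) (b : Y),
    continuous_linear X Y T /\ forall x, P x -> f x = T x + b.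

Lemma PL_affine_pieces X Y (f : X -> Y) (I : finType) (P : I -> set X) :
  (forall i, affine_piece f (P i)) -> (forall x, exists i, P i x) -> PL X Y f.
Proof.
move=> fP cover.
have [T TP] := choice (fun i => (fP i).2).
have [b bP] := choice TP.
exists #|I|, (fun k => T (enum_val k)), (fun k => P (enum_val k)),
  (fun k => b (enum_val k)); split.
- by move=> k; have [] := bP (enum_val k).
- by move=> k; have [] := fP (enum_val k).
- apply/seteqP; split=> // x _; have [i Pix] := cover x.
  by exists (enum_rank i) => //; rewrite enum_rankK.
- by move=> k; have [_] := bP (enum_val k).
Qed.

(** * Polyhedra contained in a graph *)

Lemma gphP X Y (f : X -> Y) x y : gph f (x, y) <-> y = f x.
Proof. by split=> [[z _ [-> ->]]|->] //; exists x. Qed.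

(** Gives a step length that respects all inactive constraints at once, [d i] being their slack. *)
Lemma small_multiples_le (I : finType) (A : pred I) (a d : I -> R) :
  (forall i, A i -> 0 < d i) ->
  exists2 e, 0 < e & forall i, A i -> e * a i <= d i.
Proof.
(* [S] dominates every ratio [|a i| / d i]; the summand 1 keeps it positive when no index satisfies
   [A]. *)
move=> d0; pose S := 1 + \sum_(i | A i) `|a i| / d i.
have S_ge i : A i -> `|a i| / d i <= S.
  move=> Ai; rewrite /S (bigD1 i)//= addrCA lerDl addr_ge0// sumr_ge0// => j.
  by move=> /andP[Aj _]; rewrite divr_ge0// ltW// d0.
have S0 : 0 < S.
  rewrite ltr_pwDl// sumr_ge0// => j Aj.
  by rewrite divr_ge0// ltW// d0.
exists S^-1 => [|i Ai]; first by rewrite invr_gt0.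
rewrite mulrC ler_pdivrMr// mulrC -ler_pdivrMr ?d0//.
by apply: le_trans (S_ge _ Ai); rewrite ler_pM2r ?invr_gt0 ?d0// ler_norm.
Qed.

(* If the active functionals had a common zero [y <> 0], then [f x] could be
   moved along [y] inside the polyhedron, hence inside the graph. *)
Lemma active_constraints_total X Y (f : X -> Y) n
    (u : 'I_n -> X * Y -> R^o) (s : 'I_n -> R) x :
  (forall i, topological_dual (X * Y)%type (u i)) ->
  (forall z, (forall i, u i z <= s i) -> gph f z) ->
  (forall i, u i (x, f x) <= s i) ->
  forall y, (forall i, u i (x, f x) = s i -> u i (0, y) = 0) -> y = 0.
Proof.
move=> uXY ugph ux y uy.
have uD i e : u i (x, f x + e *: y) = u i (x, f x) + e * u i (0, y).
  rewrite (_ : (x, f x + e *: y) = e *: (0, y) + (x, f x)).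
    by have [-> _] := uXY i; rewrite addrC.
  by apply: injective_projections; rewrite /= ?scaler0 ?add0r// addrC.
have [|e e0 eP] := @small_multiples_le _ (fun i => u i (x, f x) != s i)
    (fun i => u i (0, y)) (fun i => s i - u i (x, f x)).
  by move=> i iA; rewrite subr_gt0 lt_neqAle iA ux.
(* The graph has only one point above [x], which forces [e *: y = 0] with [e > 0]. *)
have /gphP/eqP : gph f (x, f x + e *: y).
  apply: ugph => i; rewrite uD; have [uis|uis] := eqVneq (u i (x, f x)) (s i).
    by rewrite uy// mulr0 addr0.
  by rewrite -lerBrDl eP.
by rewrite -subr_eq0 addrAC subrr add0r scaler_eq0 gt_eqF//= => /eqP.
Qed.

Lemma active_constraints_expansion X Y (f : X -> Y) n
    (u : 'I_n -> X * Y -> R^o) (s : 'I_n -> R) x :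
  (forall i, topological_dual (X * Y)%type (u i)) ->
  (forall z, (forall i, u i z <= s i) -> gph f z) ->
  (forall i, u i (x, f x) <= s i) ->
  exists g : 'I_n -> Y,
    forall y, y = \sum_(i | u i (x, f x) == s i) u i (0, y) *: g i.
Proof.
move=> uXY ugph ux.
have inj2 : linear (fun y : Y => (0 : X, y)).
  by move=> a v w; apply: injective_projections; rewrite /= ?scaler0 ?addr0.
have /choice[c cE] i : exists c : {linear Y -> R^o}, forall y, c y = u i (0, y).
  have [ui _] := uXY i.
  have [|c cE] := @linear_bundle _ _ _ (fun y : Y => u i (0, y)).
    by move=> a v w; rewrite inj2 ui.
  by exists c => y; rewrite -cE.
have [|g gP] := @total_functionals_expansion _ Y _
    [set i | u i (x, f x) == s i]%SET c.
  move=> y cy; apply: (active_constraints_total uXY ugph ux) => i uis.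
  by rewrite -cE cy// inE uis.
exists g => y; rewrite [LHS]gP; apply: eq_big => [i|i _]; first by rewrite inE.
by rewrite cE.
Qed.

Lemma PL1_finite_dimensional X Y : PL1 X Y !=set0 -> finite_dimensional Y.
Proof.
move=> [f [m [L [polyL gphL]]]].
have : gph f (0, f 0) by apply/gphP.
rewrite gphL => -[i _ Li]; have [n [u [s [uXY LE]]]] := polyL i.
have [||g gP] := @active_constraints_expansion X Y f n u s 0 uXY.
- by move=> z uz; rewrite gphL; exists i => //; rewrite LE.
- by move: Li; rewrite LE.
exists n, g => y.
(* Inactive constraints get coefficient 0, so the spanning family is indexed by all of ['I_n]. *)
exists (fun i => if u i (0, f 0) == s i then u i (0, y) else 0).
rewrite [LHS]gP big_mkcond; apply: eq_bigr => j _.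
by case: ifP => // _; rewrite scale0r.
Qed.

(** Vectors [g] found at one point [x0] with active set [A] serve every such point: there
    [u i (x, f x) = s i] gives [u i (0, f x) = s i - u i (x, 0)] for [i] in [A], and expanding [f x]
    along [g] yields [T x + b]. *)
Lemma active_set_piece X Y (f : X -> Y) n
    (u : 'I_n -> X * Y -> R^o) (s : 'I_n -> R) (A : {set 'I_n}) :
  (forall i, topological_dual (X * Y)%type (u i)) ->
  (forall z, (forall i, u i z <= s i) -> gph f z) ->
  exists P, affine_piece f P /\
    forall x, (forall i, u i (x, f x) <= s i) ->
      (forall i, (u i (x, f x) == s i) = (i \in A)) -> P x.
Proof.
move=> uXY ugph.
(* An active set that never occurs is given the empty piece. *)
have [[x0 [ux0 Ax0]]|no] := pselect (exists x, (forall i, u i (x, f x) <= s i) /\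
    forall i, (u i (x, f x) == s i) = (i \in A)); last first.
  exists set0; split; last by move=> x ux Ax; apply: no; exists x.
  split; first exact: polyhedron0.
  by exists (fun=> 0), 0; split => //; exact: continuous_linear0.
have [g gP] := active_constraints_expansion uXY ugph ux0.
pose T x := \sum_(i in A) (- u i (x, 0)) *: g i.
pose b := \sum_(i in A) s i *: g i.
have TXY : continuous_linear X Y T.
  apply: continuous_linear_sum => i _; apply: continuous_linear_scale.
  apply: continuous_linearN; apply: continuous_linear_comp (uXY i).
  by apply: continuous_linear_pair; [exact: continuous_linear_id|
                                     exact: continuous_linear0].
have pairE x : (x, T x) + (0, b) = (x, T x + b) 
  by apply: injective_projections; rewrite /= ?addr0.
exists [set x | forall i, u i ((x, T x) + (0, b)) <= s i]; split; first split.
- pose P : set (X * Y) := [set z | forall i, u i z <= s i].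
  apply: (@polyhedron_preimage _ _ _ _ P); last by exists n, u, s.
  by apply: continuous_linear_pair => //; exact: continuous_linear_id.
(* The active set at a point of the piece may differ from [A]; the formula still holds because
   [(x, T x + b)] lies in the polyhedron, hence in the graph. *)
- exists T, b; split=> // x ux; apply/esym/gphP/ugph => i.
  by rewrite -pairE.
- move=> x ux Ax i; rewrite pairE.
  suff -> : T x + b = f x by [].
  rewrite [RHS]gP /T /b -big_split /=; apply: eq_big => [j|j].
    by rewrite Ax0.
  move=> jA; rewrite -scalerDl; congr (_ *: _).
  have /eqP <- : u j (x, f x) == s j by rewrite Ax.
  have -> : (x, f x) = (x, 0) + (0, f x) 
    by apply: injective_projections; rewrite /= ?addr0 ?add0r.
  by have [/linear_bundle[F ->] _] := uXY j; rewrite linearD /= addKr.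
Qed.

Lemma PL1_sub_PL X Y : PL1 X Y `<=` PL X Y.
Proof.
move=> f [m [L [polyL gphL]]].
(* The number of constraints depends on [i], so the witnesses are extracted successively as
   dependent families. *)
pose nP i := cid (polyL i); pose n i := sval (nP i).
pose uP i := cid (svalP (nP i)); pose u i := sval (uP i).
pose tP i := cid (svalP (uP i)); pose s i := sval (tP i).
have sP i : (forall k, topological_dual (X * Y)%type (u i k)) /\
  L i = [set z | forall k, u i k z <= s i k] := svalP (tP i).
have ugph i z : (forall k, u i k z <= s i k) -> gph f z.
  by move=> uz; rewrite gphL; exists i => //; have [_ ->] := sP i.
(* Pieces are indexed by pairs of a polyhedron and a set of its constraints, which form a finite
   type. *)
have piece (t : {i : 'I_m & {set 'I_(n i)}}) :=
  active_set_piece (tagged t) (sP (tag t)).1 (ugph (tag t)).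
have [P PP] := choice piece.
apply: (@PL_affine_pieces _ _ _ _ P) => [t|x]; first by have [] := PP t.
have : gph f (x, f x) by apply/gphP.
rewrite gphL => -[i _]; have [_ -> /= ux] := sP i.
pose A : {set 'I_(n i)} := [set k | u i k (x, f x) == s i k]%SET.
exists (Tagged (fun i => {set 'I_(n i)}) A).
have [_] := PP (Tagged (fun i => {set 'I_(n i)}) A).
by apply => //= k; rewrite inE.
Qed.

End polyhedra.

(** * Bases and continuous coordinates in finite dimension *)

Section finite_dimension.
Context {R : realType}.
Implicit Types X Y : normedModType R.

Definition spanning Y n (e : 'I_n -> Y) : Prop :=
  forall y, exists c : 'I_n -> R, y = \sum_(i < n) c i *: e i.

Definition linear_combination Y n (e : 'I_n -> Y) (v : 'rV[R]_n) : Y :=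
  \sum_(i < n) v 0 i *: e i.

Lemma linear_combination_linear Y n (e : 'I_n -> Y) :
  linear (linear_combination e).
Proof.
move=> a v w; rewrite /linear_combination scaler_sumr -big_split /=.
by apply: eq_bigr => i _; rewrite !mxE scalerDl scalerA.
Qed.

Lemma linear_combination_continuous Y n (e : 'I_n -> Y) :
  continuous (linear_combination e).
Proof.
move=> v; apply: (@cvg_big Y _ +%R 0 xpredT _ _ (nbhs v)) => [|i _].
  exact: add_continuous.
by apply: continuousZr_tmp; exact: coord_continuous.
Qed.

(** A relation with [v 0 k != 0] expresses [e k] through the other vectors, which would then form a
    shorter spanning family. *)
Lemma minimal_spanning_free Y n (e : 'I_n -> Y) :
  spanning e -> (forall m (e' : 'I_m -> Y), spanning e' -> (n <= m)%N) ->
  forall v, linear_combination e v = 0 -> v = 0.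
Proof.
case: n e => [|n] e span minn v; first by move=> _; apply/rowP => -[].
move=> ev0; apply/rowP => k; rewrite mxE; apply/eqP/negP => /negP vk0.
have ek : e k = \sum_(i < n) (- (v 0 k)^-1 * v 0 (lift k i)) *: e (lift k i).
  move: ev0; rewrite /linear_combination (bigD1_ord k)//= => /eqP.
  rewrite addr_eq0 => /eqP/(congr1 (fun y => (v 0 k)^-1 *: y)).
  rewrite scalerA mulVf// scale1r => ->; rewrite scalerN -scaleNr scaler_sumr.
  by apply: eq_bigr => i _; rewrite scalerA.
suff /minn : spanning (fun i : 'I_n => e (lift k i)) by rewrite ltnn.
move=> y; have [c ->] := span y.
exists (fun i => c k * (- (v 0 k)^-1 * v 0 (lift k i)) + c (lift k i)).
rewrite (bigD1_ord k)//= ek scaler_sumr -big_split; apply: eq_bigr => i _.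
by rewrite scalerDl scalerA.
Qed.

Lemma finite_dimensional_free Y : finite_dimensional Y ->
  exists n (e : 'I_n -> Y),
    spanning e /\ forall v, linear_combination e v = 0 -> v = 0.
Proof.
move=> [n0 [e0 span0]].
have ex : exists n, `[< exists e : 'I_n -> Y, spanning e >].
  by exists n0; apply/asboolP; exists e0.
case: (ex_minnP ex) => n /asboolP[e span] minn.
exists n, e; split=> //; apply: minimal_spanning_free => // m e' span'.
by apply: minn; apply/asboolP; exists e'.
Qed.

(* The constant is the minimum of the norm over the compact unit sphere. *)
Lemma free_combination_norm_ge Y n (e : 'I_n -> Y) :
  (forall v, linear_combination e v = 0 -> v = 0) ->
  exists2 m : R, 0 < m & forall v, m * `|v| <= `|linear_combination e v|.
Proof.
move=> free; pose S := [set v : 'rV[R]_n | `|v| = 1].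
have [F FE] := linear_bundle (@linear_combination_linear Y n e).
(* An empty sphere means that zero is the only row vector, and any positive constant works. *)
have [S0|S0] := pselect (S !=set0); last first.
  exists 1 => // v; have [->|v0] := eqVneq v 0; first by rewrite normr0 mulr0.
  exfalso; apply: S0; exists (`|v|^-1 *: v).
  by rewrite /S /= normrZ normfV normr_id mulVf// normr_eq0.
have cS : compact S.
  apply: bounded_closed_compact.
    by exists 1; split=> // x x1 v /= ->; exact: ltW.
  apply: (@closed_comp _ _ (fun v : 'rV[R]_n => `|v|) [set 1]).
    by move=> v _; exact: norm_continuous.
  exact: closed_eq.
have [|c + cmin] := @EVT_min_rV R n (fun v => `|linear_combination e v|) S S0 cS.
  apply: continuous_subspaceT => v; apply: continuous_comp.
    exact: linear_combination_continuous.
  exact: norm_continuous.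
rewrite inE => Sc.
exists `|linear_combination e c|.
  rewrite normr_gt0; apply/negP => /eqP/free c0.
  by move: Sc; rewrite /S /= c0 normr0 => /esym/eqP; rewrite oner_eq0.
move=> v; have [->|v0] := eqVneq v 0; first by rewrite normr0 mulr0.
have nv : 0 < `|v| by rewrite normr_gt0.
rewrite -ler_pdivlMr// mulrC.
have -> : `|v|^-1 * `|linear_combination e v| =
    `|linear_combination e (`|v|^-1 *: v)|.
  by rewrite FE linearZ normrZ normfV normr_id.
apply: cmin; rewrite inE /S /=.
by rewrite normrZ normfV normr_id mulVf// gt_eqF.
Qed.

(** The functionals are the coordinates in a basis. They are continuous because the lower bound [m]
    on combinations, applied to [g y], gives [|g y| <= m^-1 * |y|]. *)
Lemma finite_dimensional_total_dual Y : finite_dimensional Y ->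
  exists n (phi : 'I_n -> Y -> R^o), (forall i, topological_dual Y (phi i)) /\
    forall y, (forall i, phi i y = 0) -> y = 0.
Proof.
move=> /finite_dimensional_free[n [e [span free]]].
have [F FE] := linear_bundle (@linear_combination_linear Y n e).
have /choice[g gE] y : exists v, y = linear_combination e v.
  have [c ->] := span y; exists (\row_i c i).
  by apply: eq_bigr => i _; rewrite mxE.
have glin : linear g.
  move=> a y z; apply/eqP; rewrite -subr_eq0; apply/eqP/free.
  by rewrite FE linearB linearP /= -FE -!gE subrr.
have [m m0 mle] := free_combination_norm_ge free.
have gc : continuous g.
  have [G GE] := linear_bundle glin; rewrite GE.
  apply/linear_bounded_continuous/linear_boundedP.
  near=> r => y; rewrite -GE.
  apply: (@le_trans _ _ (m^-1 * `|y|)).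
    by rewrite mulrC ler_pdivlMr// mulrC [in leRHS](gE y).
  by rewrite ler_wpM2r//; near: r; exact: nbhs_pinfty_ge.
exists n, (fun i y => g y 0 i); split=> [i|y gy0].
  split=> [a y z|y]; first by rewrite glin !mxE.
  by apply: (@continuous_comp _ _ _ g (fun v : 'rV[R]_n => v 0 i));
    [exact: gc|exact: coord_continuous].
rewrite (gE y) /linear_combination big1// => i _.
by rewrite gy0 scale0r.
Unshelve. all: by end_near. Qed.

Lemma finite_dimensional_polyhedron_origin Y :
  finite_dimensional Y -> polyhedron Y [set 0].
Proof.
move=> /finite_dimensional_total_dual[n [phi [phiY phi0]]].
rewrite (_ : [set 0] = [set y | forall i : 'I_n + 'I_n,
    match i with inl j => phi j y | inr j => - phi j y end <= 0]).
  apply: (@polyhedron_finType _ _ _ (fun (i : 'I_n + 'I_n) y =>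
    match i with inl j => phi j y | inr j => - phi j y end) (fun=> 0)).
  by case=> i; [exact: phiY|exact: continuous_linearN (phiY i)].
apply/seteqP; split=> [_ ->|y /= phiy].
  case=> i; have [/linear_bundle[F ->] _] := phiY i;
    by rewrite linear0 ?oppr0.
apply: phi0 => i; apply/eqP; rewrite eq_le (phiy (inl i)).
by have := phiy (inr i); rewrite oppr_le0.
Qed.

Lemma PL_sub_PL1 X Y : finite_dimensional Y -> PL X Y `<=` PL1 X Y.
Proof.
move=> /finite_dimensional_polyhedron_origin poly0 f.
move=> [m [T [P [b [TXY polyP cover fE]]]]].
(* A cylinder over [P i] meets the graph of [T i + b i]; [z.1 + 0] matches the affine form in
   [polyhedron_preimage]. *)
exists m, (fun i => [set z : X * Y | P i (z.1 + 0)] `&`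
  [set z | [set 0] ((z.2 - T i z.1) + - b i)]); split=> [i|].
  apply: polyhedronI; apply: polyhedron_preimage => //.
    exact: continuous_linear_fst.
  apply: continuous_linearD; first exact: continuous_linear_snd.
  apply: continuous_linearN.
  exact: continuous_linear_comp (@continuous_linear_fst _ X Y) (TXY i).
apply/seteqP; split=> [[x y] /gphP -> | [x y] [i _ /= []]].
  have : [set: X] x by [].
  rewrite cover => -[i _ Pix]; exists i => //=; rewrite addr0; split=> //.
  by rewrite (fE i x Pix) -addrA -opprD subrr.
rewrite addr0 => /fE fx /eqP; rewrite -addrA -opprD subr_eq0 => /eqP ->.
by apply/gphP; rewrite fx.
Qed.

End finite_dimension.

Theorem proposition3p1 (R : realType) (X Y : normedModType R) :
  [/\ continuous_linear X Y `<=` PL X Y,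
      (PL1 X Y !=set0 <-> finite_dimensional Y) /\
      (~ finite_dimensional Y ->
         forall f : X -> Y, linear f -> ~ PL1 X Y f) &
      finite_dimensional Y -> PL1 X Y = PL X Y].
Proof.
have linPL : continuous_linear X Y `<=` PL X Y.
  move=> T TXY; apply: (@PL_affine_pieces _ _ _ _ unit (fun=> setT)) => [_|x].
    split; first exact: polyhedronT.
    by exists T, 0; split=> // x _; rewrite addr0.
  by exists tt.
split=> //; last first.
  move=> finY; apply/seteqP; split; first exact: PL1_sub_PL.
  exact: PL_sub_PL1.
split; first split.
- exact: PL1_finite_dimensional.
(* The zero map is linear and continuous, hence in [PL], and so in [PL1] for finite dimensional
   [Y]. *)
- move=> finY; exists (fun=> 0); apply: PL_sub_PL1 => //; apply: linPL.
  exact: continuous_linear0.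
- by move=> infY f _ fPL1; apply: infY; apply: (@PL1_finite_dimensional _ X); exists f.
Qed.
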